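(* Let $G$ be a finite group with an idempotent partial action $\{e_\sigma,\alpha_\sigma\}_{\sigma\in G}$ on an algebra $A$. Let $\mathcal C$ be the associated $A$-coring. Then $A$ is a cleft extension of its $G$-invariant subalgebra if and only if $A$ is a cleft bicomodule for the pure coring extension $k(G)$ of $\mathcal C$.
   Context: Fix a commutative ring $k$; all algebras are associative unital $k$-algebras. Partial actions. An idempotent partial action of a finite group $G$ (unit element $1$) on $A$ consists of central idempotents $\{e_\sigma\}_{\sigma\in G}$ of $A$ and isomorphisms of ideals (as $k$-algebras) $\alpha_\sigma:Ae_{\sigma^{-1}}\to Ae_\sigma$ such that $Ae_1=A$, $\alpha_1=\mathrm{id}_A$, and $\alpha_\sigma\big(\alpha_\tau(ae_{\tau^{-1}})e_{\sigma^{-1}}\big)=\alpha_{\sigma\tau}(ae_{\tau^{-1}\sigma^{-1}})e_\sigma$ for $\sigma,\tau\in G$, $a\in A$. The coring. $\mathcal C=\bigoplus_{\sigma\in G}Ae_\sigma$; let $\nu_\sigma\in\mathcal C$ be the element equal to $e_\sigma$ in component $\sigma$ and $0$ elsewhere. The bimodule structure is $a_1(a\nu_\sigma)a_2=a_1a\alpha_\sigma(a_2e_{\sigma^{-1}})\nu_\sigma$, the coproduct $\Delta_{\mathcal C}(a\nu_\sigma)=\sum_{\tau\in G}a\nu_\tau\otimes_A\nu_{\tau^{-1}\sigma}$ and the counit $\epsilon_{\mathcal C}(a\nu_\sigma)=a\delta_{\sigma,1}$. Let $k(G)$ be the coalgebra $k$-dual to the group algebra, with dual basis $\{u_\sigma\}$,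 $\Delta(u_\sigma)=\sum_\tau u_\tau\otimes_ku_{\tau^{-1}\sigma}$, $\epsilon(u_\sigma)=\delta_{\sigma,1}$. The $k$-coring $k(G)$ is a pure right extension of $\mathcal C$ via the coaction $\tau_{\mathcal C}:a\nu_\sigma\mapsto\sum_{\tau\in G}a\nu_\tau\otimes_ku_{\tau^{-1}\sigma}$. The grouplike element $\sum_\sigma\nu_\sigma$ makes the right regular $A$-module $A$ a right $\mathcal C$-comodule, $a\mapsto\sum_\sigma1_A\otimes_A\nu_\sigma a$, hence a right $k(G)$-comodule with coaction $a\mapsto\sum_\sigma\alpha_\sigma(ae_{\sigma^{-1}})\otimes_ku_\sigma$. These are the structures used in the claim. Cleft extension. $A$ is a cleft extension of its $G$-invariant subalgebra $\{a\in A\mid\alpha_\sigma(ae_{\sigma^{-1}})=ae_\sigma\ \forall\sigma\in G\}$ if there is a convolution invertible right $k(G)$-colinear map $k(G)\to A$ ($k(G)$ with right regular coaction; convolution $(fg)(d)=f(d_{(1)})g(d_{(2)})$ in $\mathrm{Hom}_k(k(G),A)$). Cleft bicomodules. Let $\mathcal C$ be an $A$-coring (coproduct $c\mapsto c^{(1)}\otimes_Ac^{(2)}$, right coactions $m\mapsto m^{[0]}\otimes_Am^{[1]}$) with a $k$-coalgebra $\mathcal D$ as a pure right extension, with left $\mathcal C$-colinear coaction $c\mapsto c_{[0]}\otimes_kc_{[1]}$; any right $\mathcal C$-comodule $M$ is a right $\mathcal D$-comodule via $m\mapsto m^{[0]}\epsilon_{\mathcal C}({m^{[1]}}_{[0]})\otimes_k{m^{[1]}}_{[1]}$.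 For a right $\mathcal C$-comodule $\Sigma$ put $T=\mathrm{End}^{\mathcal C}(\Sigma)$, $\Sigma^*=\mathrm{Hom}_A(\Sigma,A)$ and $$\widetilde Q=\{q\in{}_A\mathrm{Hom}(\mathcal C,\Sigma^* )\mid c^{(1)}q(c^{(2)})(x)=q(c)(x^{[0]})x^{[1]}\ \forall x\in\Sigma,c\in\mathcal C\}.$$ For $p\in\mathrm{Hom}^{\mathcal D}(\mathcal D,\Sigma)$ and $q\in\widetilde Q$ put $(q\bullet p)(c)=q(c_{[0]})\big(p(c_{[1]})^{[0]}\big)p(c_{[1]})^{[1]}$ and $(p\lozenge q)(d)=p(d)^{[0]}q(p(d)^{[1]})(-)\in T$. $\Sigma$ is a cleft bicomodule for the extension if there exist $j\in\mathrm{Hom}^{\mathcal D}(\mathcal D,\Sigma)$, $\tilde\jmath\in\widetilde Q$ with $\tilde\jmath\bullet j=\mathrm{id}_{\mathcal C}$ and $j\lozenge\tilde\jmath=\epsilon_{\mathcal D}(-)1_T$. *)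

(* Defs.v *)
From HB Require Import structures.
From mathcomp Require Import all_boot all_fingroup all_algebra.
From mathcomp Require Import generic_quotient.
From mathcomp Require Import boolp.

Set Implicit Arguments.
Unset Strict Implicit.
Unset Printing Implicit Defensive.

Import GRing.Theory.
Local Open Scope ring_scope.
Local Open Scope quotient_scope.
#[local] Obligation Tactic := idtac.

Reserved Notation "a ▷ x" (at level 38, right associativity).
Reserved Notation "x ◁ a" (at level 39, left associativity).
Reserved Notation "x ⊗ y" (at level 40, left associativity).

(* MathComp's algType excludes the zero algebra; here a k-algebra is a ring    *)
(* with a ring morphism from k to its centre.                                  *)
Record kalg (k : comPzRingType) := KAlg {
  kalg_ring :> pzRingType;
  kscal : {rmorphism k -> kalg_ring};
  kscalC : forall c a, kscal c * a = a * kscal c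
}.

Definition kself (k : comPzRingType) : kalg k :=
  @KAlg k k idfun (fun c a => mulrC c a).

(* All bimodules are k-symmetric; a right B-module is a bimod (kself k) B.     *)
Record bimod (k : comPzRingType) (A B : kalg k) := Bimod {
  bm_car :> zmodType;
  lact : A -> bm_car -> bm_car;
  ract : bm_car -> B -> bm_car;
  lactDr : forall a x y, lact a (x + y) = lact a x + lact a y;
  lactDl : forall a b x, lact (a + b) x = lact a x + lact b x;
  lactA : forall a b x, lact a (lact b x) = lact (a * b) x;
  lact1 : forall x, lact 1 x = x;
  ractDl : forall x y b, ract (x + y) b = ract x b + ract y b;
  ractDr : forall x b c, ract x (b + c) = ract x b + ract x c;
  ractA : forall x b c, ract (ract x b) c = ract x (b * c);
  ract1 : forall x, ract x 1 = x;
  lractA : forall a x b, ract (lact a x) b = lact a (ract x b);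
  bm_central : forall c x, lact (kscal A c) x = ract x (kscal B c)
}.

Arguments lact : simpl never.
Arguments ract : simpl never.

Notation "a ▷ x" := (lact a x) : ring_scope.
Notation "x ◁ a" := (ract x a) : ring_scope.

Definition bm_hom k (A B : kalg k) (M N : bimod A B) (f : M -> N) : Prop :=
  [/\ forall x y, f (x + y) = f x + f y,
      forall a x, f (a ▷ x) = a ▷ f x &
      forall x b, f (x ◁ b) = f x ◁ b].

Section BimodInstances.
Variables (k : comPzRingType) (A B : kalg k).

Program Definition breg : bimod A A :=
  @Bimod k A A A (fun a x => a * x) (fun x a => x * a) _ _ _ _ _ _ _ _ _ _.
Next Obligation. exact: mulrDr. Qed.
Next Obligation. exact: mulrDl. Qed.
Next Obligation. exact: mulrA. Qed.
Next Obligation. exact: mul1r. Qed.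
Next Obligation. exact: mulrDl. Qed.
Next Obligation. exact: mulrDr. Qed.
Next Obligation. by move=> x b c /=; rewrite mulrA. Qed.
Next Obligation. exact: mulr1. Qed.
Next Obligation. by move=> a x b /=; rewrite mulrA. Qed.
Next Obligation. exact: kscalC. Qed.

Variable M : bimod A B.

(* Restriction of scalars along k -> B, resp. k -> A. *)
Program Definition rres : bimod A (kself k) :=
  @Bimod k A (kself k) M (fun a x => a ▷ x) (fun x c => x ◁ kscal B c)
    _ _ _ _ _ _ _ _ _ _.
Next Obligation. exact: lactDr. Qed.
Next Obligation. exact: lactDl. Qed.
Next Obligation. exact: lactA. Qed.
Next Obligation. exact: lact1. Qed.
Next Obligation. by move=> /= x y b; rewrite ractDl. Qed.
Next Obligation. by move=> /= x b c; rewrite rmorphD ractDr. Qed.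
Next Obligation. by move=> /= x b c; rewrite rmorphM ractA. Qed.
Next Obligation. by move=> /= x; rewrite rmorph1 ract1. Qed.
Next Obligation. by move=> /= a x b; rewrite lractA. Qed.
Next Obligation. by move=> /= c x; rewrite bm_central. Qed.

Program Definition lres : bimod (kself k) B :=
  @Bimod k (kself k) B M (fun c x => kscal A c ▷ x) (fun x b => x ◁ b)
    _ _ _ _ _ _ _ _ _ _.
Next Obligation. by move=> /= b x y; rewrite lactDr. Qed.
Next Obligation. by move=> /= b c x; rewrite rmorphD lactDl. Qed.
Next Obligation. by move=> /= b c x; rewrite rmorphM lactA. Qed.
Next Obligation. by move=> /= x; rewrite rmorph1 lact1. Qed.
Next Obligation. exact: ractDl. Qed.
Next Obligation. exact: ractDr. Qed.
Next Obligation. exact: ractA. Qed.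
Next Obligation. exact: ract1. Qed.
Next Obligation. by move=> /= a x b; rewrite lractA. Qed.
Next Obligation. by move=> /= c x; rewrite bm_central. Qed.

End BimodInstances.

Section TensorGroup.
Variables (k : comPzRingType) (A B C : kalg k).
Variables (M : bimod A B) (N : bimod B C).

(* A list of pairs stands for the formal sum of the corresponding pure tensors. *)
Inductive tens_rel : seq (M * N) -> seq (M * N) -> Prop :=
| TensRefl s : tens_rel s s
| TensSym s t : tens_rel s t -> tens_rel t s
| TensTrans s t u : tens_rel s t -> tens_rel t u -> tens_rel s u
| TensCat s s' t t' :
    tens_rel s s' -> tens_rel t t' -> tens_rel (s ++ t) (s' ++ t')
| TensCom s t : tens_rel (s ++ t) (t ++ s)
| TensZero y : tens_rel [:: (0, y)] [::]
| TensAddl x x' y : tens_rel [:: (x + x', y)] [:: (x, y); (x', y)]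
| TensAddr x y y' : tens_rel [:: (x, y + y')] [:: (x, y); (x, y')]
| TensBal x b y : tens_rel [:: (x ◁ b, y)] [:: (x, b ▷ y)].

Definition tens_equiv (s t : seq (M * N)) : bool := `[< tens_rel s t >].

Lemma tens_equivP s t : reflect (tens_rel s t) (tens_equiv s t).
Proof. exact: asboolP. Qed.

Lemma tens_equiv_class : equiv_class_of tens_equiv.
Proof.
split=> [s|s t|t s u].
- exact/tens_equivP/TensRefl.
- by apply/tens_equivP/tens_equivP; exact: TensSym.
- by move=> /tens_equivP h1 /tens_equivP h2; apply/tens_equivP/(TensTrans h1 h2).
Qed.

Canonical tens_equiv_rel := EquivRelPack tens_equiv_class.

Definition tens_car := {eq_quot tens_equiv}.

HB.instance Definition _ : EqQuotient _ tens_equiv tens_car :=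
  EqQuotient.on tens_car.
HB.instance Definition _ := Choice.on tens_car.

Definition tsum (s : seq (M * N)) : tens_car := \pi_tens_car s.

Lemma tsumP s t : tsum s = tsum t <-> tens_rel s t.
Proof.
by split=> [/eqP|h]; [rewrite eqmodE => /tens_equivP|apply/eqP; rewrite eqmodE; apply/tens_equivP].
Qed.

Lemma tsum_repr (x : tens_car) : tsum (repr x) = x.
Proof. exact: reprK. Qed.

Definition tens_zero : tens_car := tsum [::].
Definition tens_add (x y : tens_car) : tens_car := tsum (repr x ++ repr y).
Definition tens_neg (s : seq (M * N)) := [seq (- p.1, p.2) | p <- s].
Definition tens_opp (x : tens_car) : tens_car := tsum (tens_neg (repr x)).

Lemma repr_rel s : tens_rel (repr (tsum s)) s.
Proof. by apply/tsumP; rewrite tsum_repr. Qed.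

Lemma tens_addE s t : tens_add (tsum s) (tsum t) = tsum (s ++ t).
Proof. by apply/tsumP/TensCat; exact: repr_rel. Qed.

Lemma tens_addA : associative tens_add.
Proof.
move=> x y z; rewrite -(tsum_repr x) -(tsum_repr y) -(tsum_repr z).
by rewrite !tens_addE catA.
Qed.

Lemma tens_addC : commutative tens_add.
Proof.
move=> x y; rewrite -(tsum_repr x) -(tsum_repr y) !tens_addE.
exact/tsumP/TensCom.
Qed.

Lemma tens_add0 : left_id tens_zero tens_add.
Proof. by move=> x; rewrite -(tsum_repr x) /tens_zero tens_addE. Qed.

Lemma tens_negP s : tens_rel (tens_neg s ++ s) [::].
Proof.
elim: s => [|[x y] s IH]; first exact: TensRefl.
have h : tens_rel ([:: (x, y)] ++ [:: (- x, y)]) [::].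
  apply: TensTrans (TensSym (TensAddl _ _ _)) _; rewrite subrr; exact: TensZero.
rewrite -(cat1s (x, y) s) /tens_neg map_cat -/(tens_neg s) catA.
apply: TensTrans (TensCat (TensCom _ _) (TensRefl _)) _.
rewrite catA; apply: TensTrans (TensCat (TensCat h (TensRefl _)) (TensRefl _)) _.
exact: IH.
Qed.

Lemma tens_addN : left_inverse tens_zero tens_opp tens_add.
Proof.
move=> x; rewrite /tens_opp -{2}(tsum_repr x) tens_addE.
exact/tsumP/tens_negP.
Qed.

HB.instance Definition _ :=
  GRing.isZmodule.Build tens_car tens_addA tens_addC tens_add0 tens_addN.

Definition tpure (x : M) (y : N) : tens_car := tsum [:: (x, y)].

Lemma tens_ind (P : tens_car -> Prop) :
  P 0 -> (forall x y t, P t -> P (tpure x y + t)) -> forall t, P t.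
Proof.
move=> P0 PS t; rewrite -(tsum_repr t).
elim: (repr t) => [|[x y] s IH]; first exact: P0.
by rewrite -cat1s -tens_addE; exact: PS.
Qed.

Lemma tpureDl x x' y : tpure (x + x') y = tpure x y + tpure x' y.
Proof. by rewrite [RHS]tens_addE; exact/tsumP/TensAddl. Qed.

Lemma tpureDr x y y' : tpure x (y + y') = tpure x y + tpure x y'.
Proof. by rewrite [RHS]tens_addE; exact/tsumP/TensAddr. Qed.

Lemma tpureB x b y : tpure (x ◁ b) y = tpure x (b ▷ y).
Proof. exact/tsumP/TensBal. Qed.

Lemma tpure0l y : tpure 0 y = 0.
Proof. exact/tsumP/TensZero. Qed.

Lemma tpure0r x : tpure x 0 = 0.
Proof. by apply: (addrI (tpure x 0)); rewrite -tpureDr !addr0. Qed.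

Section Lift.
Variable (Z : zmodType).

Definition balanced (f : M -> N -> Z) : Prop :=
  [/\ forall x x' y, f (x + x') y = f x y + f x' y,
      forall x y y', f x (y + y') = f x y + f x y' &
      forall x b y, f (x ◁ b) y = f x (b ▷ y)].

(* For balanced f this is the induced additive map (see tliftD and tliftE).   *)
Definition tlift (f : M -> N -> Z) (t : tens_car) : Z :=
  \sum_(p <- repr t) f p.1 p.2.

Lemma tlift_tsum f : balanced f ->
  forall s, tlift f (tsum s) = \sum_(p <- s) f p.1 p.2.
Proof.
case=> fl fr fb s; rewrite /tlift.
suff h u v : tens_rel u v ->
  \sum_(p <- u) f p.1 p.2 = \sum_(p <- v) f p.1 p.2 by exact/h/repr_rel.
elim=> {s u v} //.
- by move=> u v w _ -> _ ->.
- by move=> u u' v v' _ h1 _ h2; rewrite !big_cat /= h1 h2.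
- by move=> u v; rewrite !big_cat /= addrC.
- move=> y; rewrite big_seq1 big_nil /=.
  by apply: (addrI (f 0 y)); rewrite -fl !addr0.
- by move=> x x' y; rewrite !big_cons !big_nil /= !addr0 fl.
- by move=> x y y'; rewrite !big_cons !big_nil /= !addr0 fr.
- by move=> x b y; rewrite !big_seq1 /= fb.
Qed.

Lemma tliftE f : balanced f -> forall x y, tlift f (tpure x y) = f x y.
Proof. by move=> hf x y; rewrite tlift_tsum // big_seq1. Qed.

Lemma tliftD f : balanced f -> forall s t, tlift f (s + t) = tlift f s + tlift f t.
Proof.
move=> hf s t; rewrite -(tsum_repr s) -(tsum_repr t) [_ + _ in LHS]tens_addE.
by rewrite !tlift_tsum // big_cat.
Qed.

Lemma tlift0 f : balanced f -> tlift f 0 = 0.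
Proof. by move=> hf; apply: (addrI (tlift f 0)); rewrite -tliftD // !addr0. Qed.

Lemma tlift_sum f : balanced f -> forall I (r : seq I) (P : pred I) F,
  tlift f (\sum_(i <- r | P i) F i) = \sum_(i <- r | P i) tlift f (F i).
Proof. by move=> hf I r P F; apply: (big_morph _ (tliftD hf) (tlift0 hf)). Qed.

Lemma tens_ext (f g : tens_car -> Z) :
  (forall s t, f (s + t) = f s + f t) -> (forall s t, g (s + t) = g s + g t) ->
  (forall x y, f (tpure x y) = g (tpure x y)) -> f =1 g.
Proof.
move=> fD gD h; apply: tens_ind => [|x y t IH]; last by rewrite fD gD h IH.
have -> : f 0 = 0 by apply: (addrI (f 0)); rewrite -fD !addr0.
by apply: (addrI (g 0)); rewrite -gD !addr0.
Qed.

End Lift.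

End TensorGroup.

Notation "x ⊗ y" := (tpure x y) : ring_scope.

Section TensorBimod.
Variables (k : comPzRingType) (A B C : kalg k).
Variables (M : bimod A B) (N : bimod B C).

Let lt (a : A) (t : tens_car M N) : tens_car M N := tlift (fun x y => (a ▷ x) ⊗ y) t.
Let rt (t : tens_car M N) (c : C) : tens_car M N := tlift (fun x y => x ⊗ (y ◁ c)) t.

Let ltb a : balanced (fun (x : M) (y : N) => (a ▷ x) ⊗ y).
Proof.
split=> [x x' y|x y y'|x b y]; rewrite ?lactDr ?tpureDl ?tpureDr //.
by rewrite -lractA tpureB.
Qed.

Let rtb c : balanced (fun (x : M) (y : N) => x ⊗ (y ◁ c)).
Proof.
split=> [x x' y|x y y'|x b y]; rewrite ?ractDl ?tpureDl ?tpureDr //.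
by rewrite lractA tpureB.
Qed.

Let ltD a s t : lt a (s + t) = lt a s + lt a t. Proof. exact: tliftD. Qed.
Let rtD s t c : rt (s + t) c = rt s c + rt t c. Proof. exact: tliftD. Qed.
Let ltE a x y : lt a (x ⊗ y) = (a ▷ x) ⊗ y. Proof. exact: tliftE. Qed.
Let rtE x y c : rt (x ⊗ y) c = x ⊗ (y ◁ c). Proof. exact: tliftE. Qed.

Let ltDl a b t : lt (a + b) t = lt a t + lt b t.
Proof.
move: t; apply: (tens_ext (f := lt (a + b)) (g := fun t => lt a t + lt b t)).
- by move=> s t; rewrite ltD.
- by move=> s t; rewrite !ltD addrACA.
- by move=> x y; rewrite !ltE lactDl tpureDl.
Qed.

Let ltA a b t : lt a (lt b t) = lt (a * b) t.
Proof.
move: t; apply: (tens_ext (f := fun t => lt a (lt b t)) (g := lt (a * b))).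
- by move=> s t; rewrite !ltD.
- by move=> s t; rewrite ltD.
- by move=> x y; rewrite !ltE lactA.
Qed.

Let lt1 t : lt 1 t = t.
Proof.
move: t; apply: (tens_ext (f := lt 1) (g := id)).
- by move=> s t; rewrite ltD.
- by [].
- by move=> x y; rewrite ltE lact1.
Qed.

Let rtDr t b c : rt t (b + c) = rt t b + rt t c.
Proof.
move: t; apply: (tens_ext (f := fun t => rt t (b + c)) (g := fun t => rt t b + rt t c)).
- by move=> s t; rewrite rtD.
- by move=> s t; rewrite !rtD addrACA.
- by move=> x y; rewrite !rtE ractDr tpureDr.
Qed.

Let rtA t b c : rt (rt t b) c = rt t (b * c).
Proof.
move: t; apply: (tens_ext (f := fun t => rt (rt t b) c) (g := fun t => rt t (b * c))).
- by move=> s t; rewrite !rtD.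
- by move=> s t; rewrite !rtD.
- by move=> x y; rewrite !rtE ractA.
Qed.

Let rt1 t : rt t 1 = t.
Proof.
move: t; apply: (tens_ext (f := fun t => rt t 1) (g := id)).
- by move=> s t; rewrite rtD.
- by [].
- by move=> x y; rewrite rtE ract1.
Qed.

Let lrtA a t c : rt (lt a t) c = lt a (rt t c).
Proof.
move: t; apply: (tens_ext (f := fun t => rt (lt a t) c) (g := fun t => lt a (rt t c))).
- by move=> s t; rewrite ltD rtD.
- by move=> s t; rewrite rtD ltD.
- by move=> x y; rewrite ltE !rtE ltE.
Qed.

Let tcentral c t : lt (kscal A c) t = rt t (kscal C c).
Proof.
move: t; apply: (tens_ext (f := lt (kscal A c)) (g := fun t => rt t (kscal C c))).
- by move=> s t; rewrite ltD.
- by move=> s t; rewrite rtD.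
- by move=> x y; rewrite ltE rtE bm_central tpureB bm_central.
Qed.

Definition tens : bimod A C :=
  @Bimod k A C (tens_car M N) lt rt
    ltD ltDl ltA lt1 rtD rtDr rtA rt1 lrtA tcentral.

Lemma lact_pure a x y : a ▷ (x ⊗ y : tens) = (a ▷ x) ⊗ y.
Proof. exact: ltE. Qed.

Lemma ract_pure x y c : (x ⊗ y : tens) ◁ c = x ⊗ (y ◁ c).
Proof. exact: rtE. Qed.

End TensorBimod.

Section TensorMaps.
Variables (k : comPzRingType) (A B C : kalg k).

Definition tmap (A' C' : kalg k) (M : bimod A B) (M' : bimod A' B)
    (N : bimod B C) (N' : bimod B C') (f : M -> M') (g : N -> N') :
    tens M N -> tens M' N' :=
  tlift (fun x y => f x ⊗ g y).

Definition tassoc (E : kalg k) (M : bimod A B) (N : bimod B C) (P : bimod C E) :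
    tens (tens M N) P -> tens M (tens N P) :=
  tlift (fun (t : tens M N) (z : P) =>
    tlift (fun (x : M) (y : N) => (x ⊗ (y ⊗ z : tens N P) : tens M (tens N P))) t).

(* The associator (M ⊗_B N) ⊗_k P -> M ⊗_B (N ⊗_k P). *)
Definition tassock (M : bimod A B) (N : bimod B C) (P : bimod (kself k) (kself k)) :
    tens (rres (tens M N)) P -> tens M (tens (rres N) P) :=
  tlift (fun (t : rres (tens M N)) (z : P) =>
    tlift (fun (x : M) (y : N) =>
      (x ⊗ ((y : rres N) ⊗ z : tens (rres N) P) : tens M (tens (rres N) P)))
      (t : tens M N)).

End TensorMaps.

Section TensorMapsTheory.
Variables (k : comPzRingType).

Lemma bm_homD (A B : kalg k) (M N : bimod A B) (f : M -> N) :
  bm_hom f -> forall x y, f (x + y) = f x + f y.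
Proof. by case. Qed.

Lemma bm_hom0 (A B : kalg k) (M N : bimod A B) (f : M -> N) :
  bm_hom f -> f 0 = 0.
Proof. by case=> fD _ _; apply: (addrI (f 0)); rewrite -fD !addr0. Qed.

Lemma bm_hom_sum (A B : kalg k) (M N : bimod A B) (f : M -> N) :
  bm_hom f -> forall I (r : seq I) (P : pred I) F,
  f (\sum_(i <- r | P i) F i) = \sum_(i <- r | P i) f (F i).
Proof. by move=> hf I r P F; apply: (big_morph _ (bm_homD hf) (bm_hom0 hf)). Qed.

Lemma lact0 (A B : kalg k) (M : bimod A B) (a : A) : a ▷ (0 : M) = 0.
Proof. by apply: (addrI (a ▷ 0)); rewrite -lactDr !addr0. Qed.

Lemma ract0 (A B : kalg k) (M : bimod A B) (b : B) : (0 : M) ◁ b = 0.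
Proof. by apply: (addrI (0 ◁ b)); rewrite -ractDl !addr0. Qed.

Lemma lact_breg (A B : kalg k) (M : bimod A B) (a : A) (b : breg A) (x : M) :
  ((a ▷ b : breg A) : A) ▷ x = a ▷ ((b : A) ▷ x).
Proof. by rewrite lactA. Qed.

Lemma lact0l (A B : kalg k) (M : bimod A B) (x : M) : (0 : A) ▷ x = 0.
Proof. by apply: (addrI (0 ▷ x)); rewrite -lactDl !addr0. Qed.

Lemma ract0r (A B : kalg k) (M : bimod A B) (x : M) : x ◁ (0 : B) = 0.
Proof. by apply: (addrI (x ◁ 0)); rewrite -ractDr !addr0. Qed.

Lemma lact_suml (A B : kalg k) (M : bimod A B) (x : M) I (r : seq I) (P : pred I) F :
  (\sum_(i <- r | P i) F i) ▷ x = \sum_(i <- r | P i) (F i ▷ x).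
Proof.
apply: (big_morph (fun a => a ▷ x)) => [a b|]; first exact: lactDl.
by apply: (addrI (0 ▷ x)); rewrite -lactDl !addr0.
Qed.

Lemma lact_sumr (A B : kalg k) (M : bimod A B) (a : A) I (r : seq I) (P : pred I)
    (F : I -> M) :
  a ▷ (\sum_(i <- r | P i) F i) = \sum_(i <- r | P i) (a ▷ F i).
Proof. by apply: (big_morph _ (lactDr a) (lact0 M a)). Qed.

Lemma ract_suml (A B : kalg k) (M : bimod A B) (b : B) I (r : seq I) (P : pred I)
    (F : I -> M) :
  (\sum_(i <- r | P i) F i) ◁ b = \sum_(i <- r | P i) (F i ◁ b).
Proof.
apply: (big_morph (fun x => x ◁ b)) => [x y|]; [exact: ractDl|exact: ract0].
Qed.

Lemma tpure_suml (A B C : kalg k) (M : bimod A B) (N : bimod B C) (y : N)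
    I (r : seq I) (P : pred I) (F : I -> M) :
  (\sum_(i <- r | P i) F i) ⊗ y = \sum_(i <- r | P i) (F i ⊗ y).
Proof.
apply: (big_morph (fun x => x ⊗ y)) => [x x'|]; [exact: tpureDl|exact: tpure0l].
Qed.

Lemma tpure_sumr (A B C : kalg k) (M : bimod A B) (N : bimod B C) (x : M)
    I (r : seq I) (P : pred I) (F : I -> N) :
  x ⊗ (\sum_(i <- r | P i) F i) = \sum_(i <- r | P i) (x ⊗ F i).
Proof. by apply: (big_morph _ (tpureDr x) (tpure0r N x)). Qed.

Lemma tmap_balanced (A A' B C C' : kalg k) (M : bimod A B) (M' : bimod A' B)
    (N : bimod B C) (N' : bimod B C') (f : M -> M') (g : N -> N') :
  (forall x y, f (x + y) = f x + f y) -> (forall x b, f (x ◁ b) = f x ◁ b) ->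
  (forall x y, g (x + y) = g x + g y) -> (forall b x, g (b ▷ x) = b ▷ g x) ->
  balanced (fun x y => f x ⊗ g y).
Proof.
move=> fD fr gD gl; split=> [x x' y|x y y'|x b y].
- by rewrite fD tpureDl.
- by rewrite gD tpureDr.
- by rewrite fr gl tpureB.
Qed.

Lemma tassoc1_balanced (A B C E : kalg k) (M : bimod A B) (N : bimod B C)
    (P : bimod C E) (z : P) :
  balanced (fun (x : M) (y : N) => (x ⊗ (y ⊗ z : tens N P) : tens M (tens N P))).
Proof.
split=> [x x' y|x y y'|x b y]; first by rewrite tpureDl.
- by rewrite !tpureDl !tpureDr.
- by rewrite tpureB lact_pure.
Qed.

Lemma tassoc_balanced (A B C E : kalg k) (M : bimod A B) (N : bimod B C)
    (P : bimod C E) :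
  balanced (fun (t : tens M N) (z : P) =>
    tlift (fun (x : M) (y : N) => (x ⊗ (y ⊗ z : tens N P) : tens M (tens N P))) t).
Proof.
have h z := tassoc1_balanced M N (z : P).
split=> [s t z|t z z'|t c z]; first exact: tliftD.
- move: t; apply: (tens_ext (g := fun t => tlift _ t + tlift _ t)).
  + exact: tliftD.
  + by move=> s t; rewrite !tliftD // addrACA.
  + by move=> x y; rewrite !tliftE // !tpureDr.
- move: t; apply: (tens_ext (f := fun t : tens M N => tlift _ (t ◁ c))).
  + by move=> s t; rewrite ractDl tliftD.
  + exact: tliftD.
  + by move=> x y; rewrite ract_pure !tliftE // tpureB.
Qed.

Lemma tassocE (A B C E : kalg k) (M : bimod A B) (N : bimod B C) (P : bimod C E)
    (x : M) (y : N) (z : P) :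
  tassoc ((x ⊗ y : tens M N) ⊗ z) = x ⊗ (y ⊗ z : tens N P).
Proof.
by rewrite /tassoc (tliftE (tassoc_balanced M N P)) (tliftE (tassoc1_balanced _ _ _)).
Qed.

Lemma tassoc_sum (A B C E : kalg k) (M : bimod A B) (N : bimod B C) (P : bimod C E)
    I (r : seq I) (Q : pred I) F :
  tassoc (\sum_(i <- r | Q i) F i) = \sum_(i <- r | Q i) @tassoc k A B C E M N P (F i).
Proof. exact: (tlift_sum (tassoc_balanced M N P)). Qed.

Lemma tassock1_balanced (A B C : kalg k) (M : bimod A B) (N : bimod B C)
    (P : bimod (kself k) (kself k)) (z : P) :
  balanced (fun (x : M) (y : N) =>
    (x ⊗ ((y : rres N) ⊗ z : tens (rres N) P) : tens M (tens (rres N) P))).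
Proof.
split=> [x x' y|x y y'|x b y]; first by rewrite tpureDl.
- by rewrite !tpureDl !tpureDr.
- by rewrite tpureB lact_pure.
Qed.

Lemma tassock_balanced (A B C : kalg k) (M : bimod A B) (N : bimod B C)
    (P : bimod (kself k) (kself k)) :
  balanced (fun (t : rres (tens M N)) (z : P) =>
    tlift (fun (x : M) (y : N) =>
      (x ⊗ ((y : rres N) ⊗ z : tens (rres N) P) : tens M (tens (rres N) P)))
      (t : tens M N)).
Proof.
have h z := tassock1_balanced M N (z : P).
split=> [s t z|t z z'|t c z]; first exact: tliftD.
- move: t; apply: (tens_ext (g := fun t => tlift _ t + tlift _ t)).
  + exact: tliftD.
  + by move=> s t; rewrite !tliftD // addrACA.
  + by move=> x y; rewrite !tliftE // !tpureDr.
- move: t; apply: (tens_ext (f := fun t : tens M N => tlift _ (t ◁ kscal C c))).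
  + by move=> s t; rewrite ractDl tliftD.
  + exact: tliftD.
  + by move=> x y; rewrite ract_pure !tliftE // (tpureB (y : rres N)).
Qed.

Lemma tassockE (A B C : kalg k) (M : bimod A B) (N : bimod B C)
    (P : bimod (kself k) (kself k)) (x : M) (y : N) (z : P) :
  tassock ((x ⊗ y : rres (tens M N)) ⊗ z) = x ⊗ ((y : rres N) ⊗ z : tens (rres N) P).
Proof.
by rewrite /tassock (tliftE (tassock_balanced M N P)) (tliftE (tassock1_balanced _ _ _)).
Qed.

Lemma tassock_sum (A B C : kalg k) (M : bimod A B) (N : bimod B C)
    (P : bimod (kself k) (kself k)) I (r : seq I) (Q : pred I) F :
  tassock (\sum_(i <- r | Q i) F i) = \sum_(i <- r | Q i) @tassock k A B C M N P (F i).
Proof. exact: (tlift_sum (tassock_balanced M N P)). Qed.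

Lemma counitl_balanced (A : kalg k) (M : bimod A A) (f : M -> breg A) :
  bm_hom f -> balanced (fun x y : M => f x ▷ y).
Proof.
case=> fD fl fr; split=> [x x' y|x y y'|x b y].
- by rewrite fD lactDl.
- by rewrite lactDr.
- by rewrite fr lactA.
Qed.

Lemma counitr_balanced (A B : kalg k) (M : bimod B A) (C : bimod A A) (f : C -> breg A) :
  bm_hom f -> balanced (fun (x : M) (y : C) => x ◁ f y).
Proof.
case=> fD fl fr; split=> [x x' y|x y y'|x b y].
- by rewrite ractDl.
- by rewrite fD ractDr.
- by rewrite fl ractA.
Qed.

Lemma ksym_homr (A : kalg k) (M : bimod A (kself k)) (N : bimod A (kself k))
    (f : M -> N) :
  (forall x y, f (x + y) = f x + f y) -> (forall a x, f (a ▷ x) = a ▷ f x) -> bm_hom f.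
Proof. by move=> fD fl; split=> // x c; rewrite -[c]/(kscal (kself k) c) -!bm_central fl. Qed.

Lemma ksym_homl (B : kalg k) (M N : bimod (kself k) B) (f : M -> N) :
  (forall x y, f (x + y) = f x + f y) -> (forall x b, f (x ◁ b) = f x ◁ b) -> bm_hom f.
Proof. by move=> fD fr; split=> // c x; rewrite -[c]/(kscal (kself k) c) !bm_central fr. Qed.

End TensorMapsTheory.

Record coring (k : comPzRingType) (A : kalg k) := Coring {
  cor_bm :> bimod A A;
  comul : cor_bm -> tens cor_bm cor_bm;
  counit : cor_bm -> breg A;
  comul_hom : bm_hom comul;
  counit_hom : bm_hom counit;
  comulA : forall c, tassoc (tmap comul id (comul c)) = tmap id comul (comul c);
  counitl : forall c, tlift (fun c1 c2 => counit c1 ▷ c2) (comul c) = c;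
  counitr : forall c, tlift (fun c1 c2 => c1 ◁ counit c2) (comul c) = c
}.

Record rcomod (k : comPzRingType) (A : kalg k) (C : coring A) := RComod {
  rcm_mod :> bimod (kself k) A;
  coact : rcm_mod -> tens rcm_mod C;
  coact_hom : bm_hom coact;
  coactA : forall x, tassoc (tmap coact id (coact x)) = tmap id (@comul _ _ C) (coact x);
  coact1 : forall x, tlift (fun x0 x1 => x0 ◁ counit x1) (coact x) = x
}.

(* The coaction C -> C ⊗_k D of a right extension of the coring C by a        *)
(* k-coalgebra D: counital, A-k-bilinear and left C-colinear.                  *)
(* Coassociativity over D is deliberately not a field.  None of the notions    *)
(* below uses it, and the coaction attached to a partial action (pa_ext        *)
(* below) is coassociative only if all the idempotents e_sigma equal 1.        *)
(* Purity is a condition on the equalizers of right C-comodules; it holds      *)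
(* whenever D is k-flat, in particular for D = k(G), and enters no formula.    *)
Record right_ext (k : comPzRingType) (A : kalg k) (C : coring A)
    (D : coring (kself k)) := RightExt {
  ext_coact : rres C -> tens (rres C) D;
  ext_coact_hom : bm_hom ext_coact;
  ext_coact1 : forall c, tlift (fun c0 d => c0 ◁ counit d) (ext_coact c) = c;
  ext_colinear : forall c : C,
    tassock (tmap (M := rres C) (M' := rres (tens C C)) (@comul _ _ C) id (ext_coact c))
      = tmap (N := C) id ext_coact (comul c)
}.

Section Cleft.
Variables (k : comPzRingType) (A : kalg k) (D : coring (kself k)).

Definition colinear (V W : bimod (kself k) (kself k))
    (rV : V -> tens V D) (rW : W -> tens W D) (f : V -> W) : Prop :=
  bm_hom f /\ forall v, rW (f v) = tmap f id (rV v).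

Local Notation Ak := (rres (lres (breg A))).

Definition convol (f g : D -> Ak) (d : D) : A :=
  tlift (fun d1 d2 => (f d1 : A) * (g d2 : A)) (comul d).

Definition cleft_coaction (r : Ak -> tens Ak D) : Prop :=
  exists j : D -> Ak, colinear (@comul _ _ D) r j /\
    exists j' : D -> Ak, [/\ bm_hom j',
      forall d, convol j j' d = kscal A (counit d) &
      forall d, convol j' j d = kscal A (counit d)].

Variables (C : coring A) (E : right_ext C D) (S : rcomod C).

Definition ind_coact (x : rres S) : tens (rres S) D :=
  tlift (fun (x0 : S) (x1 : C) =>
    tlift (fun (c0 : rres C) (d : D) =>
             ((x0 ◁ counit (c0 : C) : rres S) ⊗ d : tens (rres S) D)) (ext_coact E x1))
  (coact (x : S)).

Let ind1 (x0 : S) (t : tens (rres C) D) : tens (rres S) D :=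
  tlift (fun (c0 : rres C) (d : D) =>
    ((x0 ◁ counit (c0 : C) : rres S) ⊗ d : tens (rres S) D)) t.

Lemma ind1_balanced (x0 : S) : balanced (fun (c0 : rres C) (d : D) =>
  ((x0 ◁ counit (c0 : C) : rres S) ⊗ d : tens (rres S) D)).
Proof.
have [eD el er] := @counit_hom _ _ C.
split=> [c c' d|c d d'|c b d].
- by rewrite eD ractDr (tpureDl (M := rres S)).
- by rewrite tpureDr.
- rewrite -tpureB; congr (_ ⊗ _).
  by rewrite (er c (kscal A b)); rewrite /= -[LHS]ractA.
Qed.

Lemma ind2_balanced : balanced (fun (x0 : S) (x1 : C) =>
  tlift (fun (c0 : rres C) (d : D) =>
    ((x0 ◁ counit (c0 : C) : rres S) ⊗ d : tens (rres S) D)) (ext_coact E x1)).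
Proof.
have [eD el er] := @counit_hom _ _ C; have [ED El Er] := ext_coact_hom E.
have b := ind1_balanced.
split=> [x x' y|x y y'|x a y].
- move: (ext_coact E y).
  apply: (tens_ext (f := ind1 (x + x')) (g := fun t => ind1 x t + ind1 x' t)).
  + by move=> s t; rewrite /ind1 tliftD.
  + by move=> s t; rewrite /ind1 !tliftD // addrACA.
  + by move=> c d; rewrite /ind1 !tliftE // ractDl (tpureDl (M := rres S)).
- by rewrite (ED y y') tliftD.
- rewrite (El a y); move: (ext_coact E y).
  apply: (tens_ext (f := ind1 (x ◁ a)) (g := fun t => ind1 x (a ▷ (t : tens (rres C) D)))).
  + by move=> s t; rewrite /ind1 tliftD.
  + by move=> s t; rewrite /ind1 lactDr tliftD.
  + move=> c d; rewrite /ind1 lact_pure !tliftE //; congr (_ ⊗ _).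
    by rewrite (el a c) ractA.
Qed.

(* q c is an element of Hom_A(S, A), whose left A-action is (a f)(x) = a f(x), *)
(* so q is written as a function of two variables.                             *)
Definition Qtilde (q : C -> S -> A) : Prop :=
  [/\ forall c x y, q c (x + y) = q c x + q c y,
      forall c x a, q c (x ◁ a) = q c x * a,
      forall c c' x, q (c + c') x = q c x + q c' x,
      forall a c x, q (a ▷ c) x = a * q c x &
      forall c x, tlift (fun c1 c2 => c1 ◁ q c2 x) (comul c)
                  = tlift (fun x0 x1 => q c x0 ▷ x1) (coact x)].

Definition bullet (q : C -> S -> A) (p : D -> rres S) (c : C) : C :=
  tlift (fun (c0 : rres C) (d : D) =>
    tlift (fun (x0 : S) (x1 : C) => q c0 x0 ▷ x1) (coact (p d : S)))
  (ext_coact E c).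

(* An element of T = End^C(S) at each d; the unit of T is the identity map of  *)
(* S, hence the right-hand side of the last condition in cleft_bicomodule.     *)
Definition lozenge (p : D -> rres S) (q : C -> S -> A) (d : D) (x : S) : S :=
  tlift (fun (x0 : S) (x1 : C) => x0 ◁ q x1 x) (coact (p d : S)).

Definition cleft_bicomodule : Prop :=
  exists (j : D -> rres S) (q : C -> S -> A),
    [/\ colinear (@comul _ _ D) ind_coact j, Qtilde q,
        forall c, bullet q j c = c &
        forall d x, lozenge j q d x = counit d ▷ x].

End Cleft.

Section FunctionCoalgebra.
Variables (k : comPzRingType) (G : finGroupType).

Lemma kact1 (B : kalg k) (M : bimod (kself k) B) (x : M) : @lact k (kself k) B M (1 : k) x = x.
Proof. exact: lact1. Qed.
Lemma kact0 (B : kalg k) (M : bimod (kself k) B) (x : M) : @lact k (kself k) B M (0 : k) x = 0.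
Proof. exact: lact0l. Qed.
Lemma kact1r (B : kalg k) (M : bimod B (kself k)) (x : M) : @ract k B (kself k) M x (1 : k) = x.
Proof. exact: ract1. Qed.
Lemma kact0r (B : kalg k) (M : bimod B (kself k)) (x : M) : @ract k B (kself k) M x (0 : k) = 0.
Proof. exact: ract0r. Qed.

Definition kG_lact (c : k) (f : {ffun G -> k}) : {ffun G -> k} := [ffun s => c * f s].
Definition kG_ract (f : {ffun G -> k}) (c : k) : {ffun G -> k} := [ffun s => f s * c].

Program Definition kG_bimod : bimod (kself k) (kself k) :=
  @Bimod k (kself k) (kself k) {ffun G -> k} kG_lact kG_ract _ _ _ _ _ _ _ _ _ _.
Next Obligation. by move=> a x y; apply/ffunP=> s; rewrite !ffunE mulrDr. Qed.
Next Obligation. by move=> a b x; apply/ffunP=> s; rewrite !ffunE mulrDl. Qed.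
Next Obligation. by move=> a b x; apply/ffunP=> s; rewrite !ffunE mulrA. Qed.
Next Obligation. by move=> x; apply/ffunP=> s; rewrite !ffunE mul1r. Qed.
Next Obligation. by move=> a x y; apply/ffunP=> s; rewrite !ffunE mulrDl. Qed.
Next Obligation. by move=> a x y; apply/ffunP=> s; rewrite !ffunE mulrDr. Qed.
Next Obligation. by move=> x b c; apply/ffunP=> s; rewrite !ffunE mulrA. Qed.
Next Obligation. by move=> x; apply/ffunP=> s; rewrite !ffunE mulr1. Qed.
Next Obligation. by move=> a x b; apply/ffunP=> s; rewrite !ffunE mulrA. Qed.
Next Obligation. by move=> c x; apply/ffunP=> s; rewrite !ffunE mulrC. Qed.

Definition kG_u (s : G) : kG_bimod := [ffun t => (t == s)%:R].

Definition kG_comul (f : kG_bimod) : tens kG_bimod kG_bimod :=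
  \sum_s (f s : kself k) ▷ \sum_t (kG_u t ⊗ kG_u (t^-1 * s)%g : tens kG_bimod kG_bimod).

Definition kG_counit (f : kG_bimod) : breg (kself k) := f 1%g.

Lemma kG_comul_hom : bm_hom kG_comul.
Proof.
apply: ksym_homr => [x y|a x]; rewrite /kG_comul.
  by rewrite -big_split; apply: eq_bigr => s _; rewrite ffunE lactDl.
by rewrite lact_sumr; apply: eq_bigr => s _; rewrite ffunE lactA.
Qed.

Lemma kG_counit_hom : bm_hom kG_counit.
Proof. by apply: ksym_homr => [x y|a x]; rewrite /kG_counit ffunE. Qed.

Lemma kG_uE s t : kG_u s t = if t == s then 1 else 0.
Proof. by rewrite ffunE; case: eqP. Qed.

Lemma kG_comul_u s : kG_comul (kG_u s) = \sum_t (kG_u t ⊗ kG_u (t^-1 * s)%g).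
Proof.
rewrite /kG_comul (bigD1 s) //= kG_uE eqxx /= kact1 [X in _ + X]big1 ?addr0 //.
by move=> t /negPf ts; rewrite kG_uE ts kact0.
Qed.

Lemma kG_counit_u s : kG_counit (kG_u s) = (if s == 1%g then 1 else 0 : k).
Proof. by rewrite /kG_counit kG_uE eq_sym. Qed.

Lemma kG_sumE (f : kG_bimod) : f = \sum_s (f s : kself k) ▷ kG_u s.
Proof.
apply/ffunP=> t; rewrite sum_ffunE (bigD1 t) //= !ffunE eqxx mulr1 big1 ?addr0 //.
by move=> s /negPf st; rewrite !ffunE eq_sym st mulr0.
Qed.

Lemma kG_ext (V : zmodType) (f g : kG_bimod -> V) :
  (forall x y, f (x + y) = f x + f y) -> (forall x y, g (x + y) = g x + g y) ->
  (forall c s, f (c ▷ kG_u s) = g (c ▷ kG_u s)) -> f =1 g.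
Proof.
move=> fD gD h x; rewrite (kG_sumE x).
have f0 : f 0 = 0 by apply: (addrI (f 0)); rewrite -fD !addr0.
have g0 : g 0 = 0 by apply: (addrI (g 0)); rewrite -gD !addr0.
by rewrite (big_morph _ fD f0) (big_morph _ gD g0); apply: eq_bigr.
Qed.

Lemma kG_comulA f :
  tassoc (tmap kG_comul id (kG_comul f)) = tmap id kG_comul (kG_comul f).
Proof.
have [cD cl cr] := kG_comul_hom.
have b1 : balanced (fun x y : kG_bimod => kG_comul x ⊗ y) by exact: tmap_balanced.
have b2 : balanced (fun x y : kG_bimod => x ⊗ kG_comul y) by exact: tmap_balanced.
rewrite /tmap {1 2}(kG_sumE f) !(bm_hom_sum kG_comul_hom) !tlift_sum // tassoc_sum.
apply: eq_bigr => s _; rewrite !cl kG_comul_u !lact_sumr !tlift_sum // tassoc_sum.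
under eq_bigr do rewrite lact_pure tliftE // cl kG_comul_u lact_sumr tpure_suml tassoc_sum.
under [RHS]eq_bigr do rewrite lact_pure tliftE // kG_comul_u tpure_sumr.
rewrite exchange_big /=; apply: eq_bigr => t _.
rewrite (reindex_inj (mulgI t)) /=; apply: eq_bigr => u _.
by rewrite lact_pure tassocE mulKg invMg mulgA.
Qed.

Lemma kG_counitl f : tlift (fun f1 f2 => kG_counit f1 ▷ f2) (kG_comul f) = f.
Proof.
have b := counitl_balanced kG_counit_hom.
have [_ cl _] := kG_counit_hom.
rewrite {2}(kG_sumE f) /kG_comul tlift_sum //; apply: eq_bigr => s _.
rewrite lact_sumr tlift_sum // (bigD1 1%g) //= lact_pure tliftE //.
rewrite cl lact_breg kG_counit_u eqxx /= kact1 invg1 mul1g big1 ?addr0 // => t /negPf t1.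
by rewrite lact_pure tliftE // cl lact_breg kG_counit_u t1 /= kact0 lact0.
Qed.

Lemma kG_counitr f : tlift (fun f1 f2 => f1 ◁ kG_counit f2) (kG_comul f) = f.
Proof.
have b := counitr_balanced kG_bimod kG_counit_hom.
rewrite {2}(kG_sumE f) /kG_comul tlift_sum //; apply: eq_bigr => s _.
rewrite lact_sumr tlift_sum // (bigD1 s) //= lact_pure tliftE //.
rewrite kG_counit_u mulVg eqxx kact1r big1 ?addr0 // => t /negPf ts.
by rewrite lact_pure tliftE // kG_counit_u -eq_mulVg1 ts kact0r.
Qed.

Definition kG : coring (kself k) :=
  Coring kG_comul_hom kG_counit_hom kG_comulA kG_counitl kG_counitr.

End FunctionCoalgebra.

(* Membership in the ideal A e, for e a central idempotent. *)
Definition in_ideal (A : pzRingType) (e a : A) : Prop := a * e = a.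

(* pact s stands for alpha_s; only its values on A e_(s^-1) are meaningful.   *)
Record paction (k : comPzRingType) (A : kalg k) (G : finGroupType) := PAction {
  pe : G -> A;
  pact : G -> A -> A;
  pe_idem : forall s, pe s * pe s = pe s;
  pe_central : forall s a, pe s * a = a * pe s;
  pact_ideal : forall s a, in_ideal (pe s^-1%g) a -> in_ideal (pe s) (pact s a);
  pactD : forall s a b, in_ideal (pe s^-1%g) a -> in_ideal (pe s^-1%g) b ->
    pact s (a + b) = pact s a + pact s b;
  pactM : forall s a b, in_ideal (pe s^-1%g) a -> in_ideal (pe s^-1%g) b ->
    pact s (a * b) = pact s a * pact s b;
  pactZ : forall s c a, in_ideal (pe s^-1%g) a ->
    pact s (kscal A c * a) = kscal A c * pact s a;
  pact_inj : forall s a b, in_ideal (pe s^-1%g) a -> in_ideal (pe s^-1%g) b ->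
    pact s a = pact s b -> a = b;
  pact_surj : forall s b, in_ideal (pe s) b ->
    exists2 a, in_ideal (pe s^-1%g) a & pact s a = b;
  pe_unit : forall a, in_ideal (pe 1%g) a;
  pact_unit : forall a, pact 1%g a = a;
  pact_comp : forall s t a,
    pact s (pact t (a * pe t^-1%g) * pe s^-1%g)
      = pact (s * t)%g (a * pe (t^-1 * s^-1)%g) * pe s
}.

Section PartialAction.
Variables (k : comPzRingType) (A : kalg k) (G : finGroupType) (pa : paction A G).
Local Notation e := (pe pa).

(* alpha_s (a e_(s^-1)) *)
Definition palpha (s : G) (a : A) : A := pact pa s (a * e s^-1%g).

Lemma in_idealM s a : in_ideal (e s) (a * e s).
Proof. by rewrite /in_ideal -mulrA pe_idem. Qed.

Lemma palpha_ideal s a : palpha s a * e s = palpha s a.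
Proof. exact/pact_ideal/in_idealM. Qed.

Lemma palphaD s a b : palpha s (a + b) = palpha s a + palpha s b.
Proof. by rewrite /palpha mulrDl pactD //; exact: in_idealM. Qed.

Lemma palphaM s a b : palpha s (a * b) = palpha s a * palpha s b.
Proof.
rewrite /palpha -pactM; try exact: in_idealM.
by rewrite -!mulrA pe_central -[b * _ * _]mulrA pe_idem.
Qed.

Lemma palphaZ s c a : palpha s (kscal A c * a) = kscal A c * palpha s a.
Proof. by rewrite /palpha -mulrA pactZ //; exact: in_idealM. Qed.

Lemma palpha1 s : palpha s 1 = e s.
Proof.
have h : in_ideal (e s) (e s) by exact: pe_idem.
have [a ha ae] := pact_surj h.
have -> : palpha s 1 = palpha s 1 * palpha s a by rewrite /palpha ha ae -/(palpha s 1) palpha_ideal.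
by rewrite -palphaM mul1r /palpha ha ae.
Qed.

Lemma pe1 : e 1%g = 1.
Proof. by rewrite -[LHS]mul1r; exact: pe_unit. Qed.

Lemma palpha_id a : palpha 1%g a = a.
Proof. by rewrite /palpha pact_unit invg1 pe1 mulr1. Qed.

Lemma palpha_comp s t a : palpha s (palpha t a) = palpha (s * t)%g a * e s.
Proof. by rewrite /palpha pact_comp invMg. Qed.

Lemma palpha_pe s t : palpha s (e t) = e (s * t)%g * e s.
Proof. by rewrite -(palpha1 t) palpha_comp palpha1. Qed.

(* The direct sum of the ideals A e_sigma. *)
Definition pcor_pred : pred {ffun G -> A} := fun x => [forall s, x s * e s == x s].

Lemma pcor_zmod_closed : zmod_closed pcor_pred.
Proof.
split=> [|x y]; rewrite !unfold_in.
  by apply/forallP=> s; rewrite ffunE mul0r.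
move=> /forallP hx /forallP hy; apply/forallP=> s.
by rewrite !ffunE mulrBl (eqP (hx s)) (eqP (hy s)).
Qed.

HB.instance Definition _ := GRing.isZmodClosed.Build _ pcor_pred pcor_zmod_closed.

Record pcor := PCor { pcor_val :> {ffun G -> A}; _ : pcor_pred pcor_val }.

HB.instance Definition _ := [isSub for pcor_val].
HB.instance Definition _ := [Choice of pcor by <:].
HB.instance Definition _ := [SubChoice_isSubZmodule of pcor by <:].

Lemma pcorP (x : pcor) s : x s * e s = x s.
Proof. by case: x => x /= /forallP h; exact/eqP. Qed.

Lemma pcor_eqP (x y : pcor) : (forall s, x s = y s) -> x = y.
Proof. by move=> h; apply/val_inj/ffunP. Qed.

Lemma pcor_mkP (f : G -> A) : pcor_pred [ffun s => f s * e s].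
Proof. by apply/forallP=> s; rewrite !ffunE -mulrA pe_idem. Qed.

Definition pcor_mk (f : G -> A) : pcor := PCor (pcor_mkP f).

Lemma pcor_mkE f s : pcor_mk f s = f s * e s.
Proof. by rewrite ffunE. Qed.

Lemma pcor_addE (x y : pcor) s : (x + y) s = x s + y s.
Proof. by rewrite ffunE. Qed.

Definition pcor_lact (a : A) (x : pcor) : pcor := pcor_mk (fun s => a * x s).
Definition pcor_ract (x : pcor) (a : A) : pcor := pcor_mk (fun s => x s * palpha s a).

Lemma pcor_lactE a x s : pcor_lact a x s = a * x s.
Proof. by rewrite pcor_mkE -mulrA pcorP. Qed.

Lemma pcor_ractE x a s : pcor_ract x a s = x s * palpha s a.
Proof. by rewrite pcor_mkE -mulrA palpha_ideal. Qed.

Local Notation pE := (pcor_addE, pcor_lactE, pcor_ractE).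

Program Definition pcor_bimod : bimod A A :=
  @Bimod k A A pcor pcor_lact pcor_ract _ _ _ _ _ _ _ _ _ _.
Next Obligation. by move=> a x y; apply/pcor_eqP=> s; rewrite !pE mulrDr. Qed.
Next Obligation. by move=> a b x; apply/pcor_eqP=> s; rewrite !pE mulrDl. Qed.
Next Obligation. by move=> a b x; apply/pcor_eqP=> s; rewrite !pE mulrA. Qed.
Next Obligation. by move=> x; apply/pcor_eqP=> s; rewrite !pE mul1r. Qed.
Next Obligation. by move=> x y b; apply/pcor_eqP=> s; rewrite !pE mulrDl. Qed.
Next Obligation. by move=> x b c; apply/pcor_eqP=> s; rewrite !pE palphaD mulrDr. Qed.
Next Obligation. by move=> x b c; apply/pcor_eqP=> s; rewrite !pE palphaM mulrA. Qed.
Next Obligation. by move=> x; apply/pcor_eqP=> s; rewrite !pE palpha1 pcorP. Qed.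
Next Obligation. by move=> a x b; apply/pcor_eqP=> s; rewrite !pE mulrA. Qed.
Next Obligation.
move=> c x; apply/pcor_eqP=> s; rewrite !pE -[kscal A c in RHS]mulr1 palphaZ palpha1.
by rewrite mulrA -kscalC -mulrA pcorP.
Qed.

Local Notation C := pcor_bimod.

(* nu a s is a nu_s, i.e. a e_s in component s. *)
Definition nu (a : A) (s : G) : C := pcor_mk (fun t => if t == s then a else 0).

Lemma nuE a s t : (nu a s : pcor) t = if t == s then a * e s else 0.
Proof. by rewrite pcor_mkE; case: eqP => [->|_]; rewrite ?mul0r. Qed.

Lemma nuDl a b s : nu (a + b) s = nu a s + nu b s.
Proof.
by apply/pcor_eqP=> t; rewrite pcor_addE !nuE; case: eqP; rewrite ?mulrDl ?addr0.
Qed.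

Lemma lact_nu a b s : a ▷ nu b s = nu (a * b) s.
Proof.
by apply/pcor_eqP=> t; rewrite pcor_lactE !nuE; case: eqP; rewrite ?mulrA ?mulr0.
Qed.

Lemma ract_nu a b s : nu a s ◁ b = nu (a * palpha s b) s.
Proof.
apply/pcor_eqP=> t; rewrite pcor_ractE !nuE; case: eqP => [->|]; rewrite ?mul0r //.
by rewrite -!mulrA pe_central.
Qed.

Lemma nu_e a s : nu (a * e s) s = nu a s.
Proof. by apply/pcor_eqP=> t; rewrite !nuE; case: eqP; rewrite // -mulrA pe_idem. Qed.

Lemma nu_mul1 a s : nu a s = a ▷ nu 1 s.
Proof. by rewrite lact_nu mulr1. Qed.

Lemma nu0 s : nu 0 s = 0.
Proof. by apply: (addrI (nu 0 s)); rewrite -nuDl !addr0. Qed.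

Lemma pcor_eval_sum I (r : seq I) (P : pred I) (F : I -> pcor) t :
  (\sum_(i <- r | P i) F i : pcor) t = \sum_(i <- r | P i) (F i t).
Proof.
apply: (big_morph (fun x : pcor => x t)) => [x y|]; first exact: pcor_addE.
by rewrite ffunE.
Qed.

Lemma pcor_sumE (x : C) : x = \sum_s nu ((x : pcor) s) s.
Proof.
apply/pcor_eqP=> t; rewrite pcor_eval_sum (bigD1 t) //= nuE eqxx pcorP.
by rewrite big1 ?addr0 // => s /negPf st; rewrite nuE eq_sym st.
Qed.

Definition pcor_comul (x : C) : tens C C :=
  \sum_s \sum_t (nu ((x : pcor) s) t ⊗ nu 1 (t^-1 * s)%g).

Definition pcor_counit (x : C) : breg A := (x : pcor) 1%g.

Lemma nu_absorb a s t (V : bimod A A) (y : V) :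
  (nu (a * e s) t ⊗ (nu 1 (t^-1 * s)%g ⊗ y : tens C V)) =
  (nu a t ⊗ (nu 1 (t^-1 * s)%g ⊗ y : tens C V)).
Proof.
rewrite -[in RHS](nu_e 1) mul1r (nu_mul1 (e _)) -lact_pure -tpureB ract_nu.
by rewrite palpha_pe mulgA mulgV mul1g mulrA nu_e.
Qed.

Lemma nu_absorb1 a s t :
  (nu (a * e s) t ⊗ nu 1 (t^-1 * s)%g) = (nu a t ⊗ nu 1 (t^-1 * s)%g).
Proof.
rewrite -[in RHS](nu_e 1) mul1r (nu_mul1 (e _)) -tpureB ract_nu.
by rewrite palpha_pe mulgA mulgV mul1g mulrA nu_e.
Qed.

Lemma pcor_comul_nu a s :
  pcor_comul (nu a s) = \sum_t (nu a t ⊗ nu 1 (t^-1 * s)%g).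
Proof.
rewrite /pcor_comul (bigD1 s) //= nuE eqxx [X in _ + X]big1 ?addr0 => [|t /negPf ts].
  by apply: eq_bigr => t _; rewrite nu_absorb1.
by rewrite nuE ts; apply: big1 => r _; rewrite nu0 tpure0l.
Qed.

Lemma pcor_comul_hom : bm_hom pcor_comul.
Proof.
split=> [x y|a x|x b]; rewrite /pcor_comul.
- rewrite -big_split; apply: eq_bigr => s _; rewrite -big_split; apply: eq_bigr => t _.
  by rewrite pcor_addE nuDl tpureDl.
- rewrite lact_sumr; apply: eq_bigr => s _; rewrite lact_sumr; apply: eq_bigr => t _.
  by rewrite pcor_lactE lact_pure lact_nu.
- rewrite ract_suml; apply: eq_bigr => s _; rewrite ract_suml; apply: eq_bigr => t _.
  rewrite pcor_ractE ract_pure ract_nu mul1r (nu_mul1 (palpha _ b)) -tpureB ract_nu.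
  by rewrite palpha_comp mulgA mulgV mul1g mulrA nu_e.
Qed.

Lemma pcor_counit_hom : bm_hom pcor_counit.
Proof.
split=> [x y|a x|x b]; rewrite /pcor_counit.
- exact: pcor_addE.
- exact: pcor_lactE.
- by rewrite pcor_ractE palpha_id.
Qed.

Lemma pcor_counit_nu a s : pcor_counit (nu a s) = if s == 1%g then a else 0.
Proof. by rewrite /pcor_counit nuE eq_sym; case: eqP => // ->; rewrite pe1 mulr1. Qed.

Lemma pcor_comulA x :
  tassoc (tmap pcor_comul id (pcor_comul x)) = tmap id pcor_comul (pcor_comul x).
Proof.
have [cD cl cr] := pcor_comul_hom.
have b1 : balanced (fun x y : C => pcor_comul x ⊗ y) by exact: tmap_balanced.
have b2 : balanced (fun x y : C => x ⊗ pcor_comul y) by exact: tmap_balanced.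
rewrite /tmap (pcor_sumE x) !(bm_hom_sum pcor_comul_hom) !tlift_sum // tassoc_sum.
apply: eq_bigr => s _; rewrite pcor_comul_nu !tlift_sum // tassoc_sum.
under eq_bigr do rewrite tliftE // pcor_comul_nu tpure_suml tassoc_sum.
under [RHS]eq_bigr do rewrite tliftE // pcor_comul_nu tpure_sumr.
rewrite exchange_big /=; apply: eq_bigr => t _.
rewrite (reindex_inj (mulgI t)) /=; apply: eq_bigr => u _.
by rewrite tassocE mulKg invMg mulgA.
Qed.

Lemma pcor_counitl x :
  tlift (fun c1 c2 => pcor_counit c1 ▷ c2) (pcor_comul x) = x.
Proof.
have b := counitl_balanced pcor_counit_hom.
rewrite {2}(pcor_sumE x) /pcor_comul tlift_sum //; apply: eq_bigr => s _.
rewrite tlift_sum // (bigD1 1%g) //= tliftE // pcor_counit_nu eqxx invg1 mul1g -nu_mul1.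
rewrite big1 ?addr0 // => t /negPf t1.
by rewrite tliftE // pcor_counit_nu t1 lact_nu mul0r nu0.
Qed.

Lemma pcor_counitr x :
  tlift (fun c1 c2 => c1 ◁ pcor_counit c2) (pcor_comul x) = x.
Proof.
have b := counitr_balanced C pcor_counit_hom.
rewrite {2}(pcor_sumE x) /pcor_comul tlift_sum //; apply: eq_bigr => s _.
rewrite tlift_sum // (bigD1 s) //= tliftE // pcor_counit_nu mulVg eqxx ract1.
rewrite big1 ?addr0 // => t /negPf ts; rewrite tliftE // pcor_counit_nu -eq_mulVg1 ts.
exact: (ract0r (M := C)).
Qed.

Definition pa_coring : coring A :=
  Coring pcor_comul_hom pcor_counit_hom pcor_comulA pcor_counitl pcor_counitr.

Local Notation D := (kG k G).

Definition pa_ext_coact (x : rres C) : tens (rres C) D :=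
  \sum_s \sum_t ((nu ((x : pcor) s) t : rres C) ⊗ (kG_u k (t^-1 * s)%g : D)).

Lemma pa_ext_coact_hom : bm_hom pa_ext_coact.
Proof.
apply: ksym_homr => [x y|a x]; rewrite /pa_ext_coact.
- rewrite -big_split; apply: eq_bigr => s _; rewrite -big_split; apply: eq_bigr => t _.
  by rewrite pcor_addE nuDl (tpureDl (M := rres C)).
- rewrite lact_sumr; apply: eq_bigr => s _; rewrite lact_sumr; apply: eq_bigr => t _.
  by rewrite pcor_lactE lact_pure -lact_nu.
Qed.

Lemma pa_ext_coact_nu a s : pa_ext_coact (nu a s) =
  \sum_t ((nu (a * e s) t : rres C) ⊗ (kG_u k (t^-1 * s)%g : D)).
Proof.
rewrite /pa_ext_coact (bigD1 s) //= nuE eqxx [X in _ + X]big1 ?addr0 // => t /negPf ts.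
by rewrite nuE ts; apply: big1 => r _; rewrite nu0 (tpure0l (rres C)).
Qed.

Lemma pa_ext_coact1 c :
  tlift (fun (c0 : rres C) (d : D) => c0 ◁ counit d) (pa_ext_coact c) = c.
Proof.
have b := counitr_balanced (rres C) (@counit_hom _ _ D).
rewrite {2}(pcor_sumE c) /pa_ext_coact tlift_sum //; apply: eq_bigr => s _.
rewrite tlift_sum // (bigD1 s) //= tliftE // kG_counit_u mulVg eqxx kact1r.
rewrite big1 ?addr0 // => t /negPf ts; rewrite tliftE // kG_counit_u -eq_mulVg1 ts.
exact: (kact0r (M := rres C)).
Qed.

Lemma pa_ext_colinear (c : C) :
  tassock (tmap (M := rres C) (M' := rres (tens C C)) pcor_comul id (pa_ext_coact c))
    = tmap (N := C) id pa_ext_coact (pcor_comul c).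
Proof.
have [cD cl cr] := pcor_comul_hom; have [ED El Er] := pa_ext_coact_hom.
have b1 : balanced (fun (x : rres C) (y : D) => (pcor_comul x : rres (tens C C)) ⊗ y).
  by apply: tmap_balanced => // x b; exact: (cr x).
have b2 : balanced (fun (x : C) (y : C) => x ⊗ pa_ext_coact y).
  by apply: (tmap_balanced (N := C)) => // b x; exact: (El b x).
rewrite /tmap [pa_ext_coact c]/pa_ext_coact [pcor_comul c]/pcor_comul !tlift_sum // tassock_sum; apply: eq_bigr => s _.
rewrite !tlift_sum // tassock_sum.
under eq_bigr do rewrite tliftE // pcor_comul_nu (tpure_suml (M := rres (tens C C))) tassock_sum.
under [RHS]eq_bigr do rewrite tliftE // pa_ext_coact_nu tpure_sumr.
rewrite exchange_big /=; apply: eq_bigr => t _.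
rewrite (reindex_inj (mulgI t)) /=; apply: eq_bigr => u _.
rewrite tassockE mulKg invMg mulgA mul1r.
rewrite [nu (e _) _]nu_mul1 -(lact_pure (M := rres C)) -tpureB ract_nu palpha_pe mulgA mulgV mul1g.
by rewrite mulrA nu_e pcorP.
Qed.

Definition pa_ext : right_ext pa_coring D :=
  @RightExt k A pa_coring D pa_ext_coact pa_ext_coact_hom pa_ext_coact1 pa_ext_colinear.

Local Notation Ar := (lres (breg A)).

Definition pa_coact (a : Ar) : tens Ar C := \sum_s ((1 : Ar) ⊗ (nu 1 s ◁ (a : A))).

Lemma pa_coact_hom : bm_hom pa_coact.
Proof.
apply: ksym_homl => [x y|x b]; rewrite /pa_coact.
- by rewrite -big_split; apply: eq_bigr => s _; rewrite ractDr tpureDr.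
- by rewrite ract_suml; apply: eq_bigr => s _; rewrite ract_pure ractA.
Qed.

Lemma pa_coactA x :
  tassoc (tmap pa_coact id (pa_coact x)) = tmap id pcor_comul (pa_coact x).
Proof.
have [cD cl cr] := pcor_comul_hom; have [ED El Er] := pa_coact_hom.
have b1 : balanced (fun (x : Ar) (y : C) => pa_coact x ⊗ y) by exact: tmap_balanced.
have b2 : balanced (fun (x : Ar) (y : C) => x ⊗ pcor_comul y) by exact: tmap_balanced.
rewrite /tmap {1 2}/pa_coact !tlift_sum // tassoc_sum.
under eq_bigr do rewrite tliftE // /pa_coact tpure_suml tassoc_sum.
under [RHS]eq_bigr do rewrite tliftE // cr pcor_comul_nu ract_suml tpure_sumr.
rewrite exchange_big [RHS]exchange_big /=; apply: eq_bigr => t _.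
rewrite [RHS](reindex_inj (mulgI t)) /=; apply: eq_bigr => u _.
by rewrite tassocE mulKg ract1 ract_pure.
Qed.

Lemma pa_coact1 x : tlift (fun (x0 : Ar) (x1 : C) => x0 ◁ pcor_counit x1) (pa_coact x) = x.
Proof.
have b := counitr_balanced Ar pcor_counit_hom.
rewrite /pa_coact tlift_sum // (bigD1 1%g) //= tliftE //.
rewrite ract_nu mul1r pcor_counit_nu eqxx palpha_id big1 => [|s /negPf s1].
  by rewrite addr0; exact: mul1r.
by rewrite tliftE // ract_nu pcor_counit_nu s1; exact: mulr0.
Qed.

Definition pa_comod : rcomod pa_coring :=
  @RComod k A pa_coring Ar pa_coact pa_coact_hom pa_coactA pa_coact1.

Definition pa_kG_coact (a : rres Ar) : tens (rres Ar) D :=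
  \sum_s ((palpha s a : rres Ar) ⊗ (kG_u k s : D)).

(* The k(G)-coaction on A is the one induced by its C-comodule structure. *)
Lemma pa_kG_coactE a : ind_coact (S := pa_comod) pa_ext a = pa_kG_coact a.
Proof.
have b := ind2_balanced pa_ext pa_comod; have b1 := @ind1_balanced _ _ D _ pa_comod.
have cuE c : @counit _ _ pa_coring c = pcor_counit c by [].
have exE c : ext_coact pa_ext c = pa_ext_coact c by [].
rewrite /ind_coact [coact _]/(pa_coact a) /pa_coact tlift_sum //; apply: eq_bigr => s _.
rewrite tliftE // ract_nu mul1r exE pa_ext_coact_nu.
rewrite tlift_sum // (bigD1 1%g) //= tliftE // ?cuE pcor_counit_nu eqxx.
rewrite invg1 mul1g palpha_ideal big1 => [|t /negPf t1].
  by rewrite addr0; congr (_ ⊗ _); exact: mul1r.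
rewrite tliftE // ?cuE pcor_counit_nu t1.
by rewrite (ract0r (M := Ar)) (tpure0l (rres Ar)).
Qed.

(* A is a cleft extension of its G-invariant subalgebra, the set of all a with *)
(* palpha s a = a * e s for all s.                                             *)
Definition pa_cleft_extension : Prop := cleft_coaction pa_kG_coact.

End PartialAction.

(* Main.v *)
Require Import Defs.
From mathcomp Require Import all_boot all_fingroup all_algebra.

(** A right k(G)-colinear map j into A is determined by the family x_s = j(u_s),
    and comparing the coefficients of u_t in the colinearity equation gives
    alpha_t(x_s) = x_(s t^-1) (lemma [colinear_palpha]).  In particular every
    x_s lies in all of the ideals A e_t.  As soon as x has a right inverse b for
    the convolution product [gconv] of functions G -> A, the equation
    1 = sum_t x_t b_(t^-1) forces e_t = 1 for all t ([pe_eq1]): both sides of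
    the equivalence can hold only when the partial action is a global one.

    On the side of the coring, the C-coaction of A is a |-> 1 (x) g a for the
    grouplike g = sum_s nu_s ([pa_coactE]), and a left linear q in Q~ is
    determined by the family b_s = q(nu_s)(1).  In terms of x and b, the two
    conditions of a cleft bicomodule are those of a convolution inverse: the
    value at u_s of the condition on T is sum_t alpha_t(x_s) b_t, which is
    (x * b)_s by the formula above ([lozengeE], [sum_palpha_gconv]), and the
    r-component of the condition on C is sum_s c_s (b * x)_(s r^-1) = c_r
    ([bulletE]).  Hence a cleft bicomodule yields the convolution inverse
    u_s |-> q(nu_s)(1) of j.

    Conversely, let b be the family of a convolution inverse of j.  The map
    c |-> (y |-> sum_s c_s b_s y) has to satisfy the equation that defines Q~,
    which comes down to alpha_r(b_(r^-1 s)) = b_s.  For a fixed r, the family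
    s |-> alpha_r(b_(r^-1 s)) is again a right inverse of x, because x is
    invariant under applying alpha_r and translating by r, and alpha_r fixes
    the unit now that e_r = 1; being inverses of the same x, this family and b
    agree ([inverse_palpha]). *)

Set Implicit Arguments.
Unset Strict Implicit.
Unset Printing Implicit Defensive.

Import GRing.Theory.
Local Open Scope ring_scope.

(** * Convolution of functions on a finite group *)

Section GroupConvolution.
Variables (R : pzRingType) (G : finGroupType).
Implicit Types f g h : G -> R.

Definition gconv f g (s : G) : R := \sum_t f t * g (t^-1 * s)%g.

Definition gdelta (s : G) : R := if s == 1%g then 1 else 0.

Lemma gconvA f g h : gconv (gconv f g) h =1 gconv f (gconv g h).
Proof.
move=> s; rewrite /gconv; under eq_bigr do rewrite mulr_suml.
rewrite exchange_big /=; apply: eq_bigr => t _.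
rewrite mulr_sumr (reindex_inj (mulgI t)) /=; apply: eq_bigr => u _.
by rewrite mulKg invMg mulgA mulrA.
Qed.

Lemma gdelta_conv f : gconv gdelta f =1 f.
Proof.
move=> s; rewrite /gconv (bigD1 1%g) //= /gdelta eqxx mul1r invg1 mul1g.
by rewrite big1 ?addr0 // => t /negPf ->; rewrite mul0r.
Qed.

Lemma gconv_delta f : gconv f gdelta =1 f.
Proof.
move=> s; rewrite /gconv (bigD1 s) //= /gdelta mulVg eqxx mulr1.
by rewrite big1 ?addr0 // => t /negPf ts; rewrite -eq_mulVg1 ts mulr0.
Qed.

Lemma gconv_inverse_uniq f g g' :
  gconv g f =1 gdelta -> gconv f g' =1 gdelta -> g =1 g'.
Proof.
move=> gf fg' s; rewrite -(gconv_delta g s).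
have -> : gconv g gdelta s = gconv g (gconv f g') s.
  by apply: eq_bigr => t _; rewrite fg'.
rewrite -gconvA -[RHS]gdelta_conv.
by apply: eq_bigr => t _; rewrite gf.
Qed.

End GroupConvolution.

Section PartialActionCleft.
Variables (k : comPzRingType) (A : kalg k) (G : finGroupType) (pa : paction A G).
Local Notation e := (pe pa).
Local Notation C := (pcor_bimod pa).
Local Notation D := (kG k G).
Local Notation Ar := (lres (breg A)).
Local Notation Ak := (rres Ar).
Local Notation alpha := (palpha pa).
Local Notation u s := (kG_u k s : D).

(** * Linear maps out of k(G) and their convolution *)

Lemma ract_Ak (x : Ak) (c : k) : x ◁ (c : kself k) = (x : A) * kscal A c.
Proof. by []. Qed.

Lemma lact_Ak (x : Ak) (c : k) : (c : kself k) ▷ x = kscal A c * (x : A).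
Proof. by []. Qed.

Lemma kG_homE (f : D -> Ak) (d : D) : bm_hom f ->
  f d = \sum_s kscal A ((d : {ffun G -> k}) s) * (f (u s) : A).
Proof.
move=> fh; rewrite {1}(kG_sumE d) (bm_hom_sum fh); apply: eq_bigr => s _.
by have [_ fl _] := fh; rewrite fl.
Qed.

Lemma convolE (f g : D -> Ak) (d : D) : bm_hom f -> bm_hom g ->
  convol f g d = \sum_s kscal A ((d : {ffun G -> k}) s) *
    gconv (fun t => f (u t) : A) (fun t => g (u t) : A) s.
Proof.
move=> [fD fl fr] [gD gl gr].
have b : balanced (fun d1 d2 : D => (f d1 : A) * (g d2 : A)).
  split=> [x x' y|x y y'|x c y]; first by rewrite fD; exact: mulrDl.
    by rewrite gD; exact: mulrDr.
  by rewrite fr gl ract_Ak lact_Ak mulrA.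
rewrite /convol [comul d]/(kG_comul d) /kG_comul tlift_sum //.
apply: eq_bigr => s _; rewrite lact_sumr tlift_sum // mulr_sumr.
by apply: eq_bigr => t _; rewrite lact_pure tliftE // fl lact_Ak -mulrA.
Qed.

Lemma kscal_counit (d : D) : kscal A (counit d) =
  \sum_s kscal A ((d : {ffun G -> k}) s) * gdelta A s.
Proof.
rewrite (bigD1 1%g) //= /gdelta eqxx mulr1 big1 ?addr0 // => s /negPf ->.
by rewrite mulr0.
Qed.

Lemma kscal_counit_u s : kscal A (counit (u s)) = gdelta A s.
Proof.
have -> : counit (u s) = if s == 1%g then 1 else 0 by exact: kG_counit_u.
by rewrite /gdelta; case: eqP => _; rewrite ?rmorph1 ?rmorph0.
Qed.

Definition kG_extend (b : G -> A) (d : D) : Ak :=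
  \sum_s kscal A ((d : {ffun G -> k}) s) * b s.

Lemma kG_extend_hom b : bm_hom (kG_extend b).
Proof.
apply: ksym_homr => [x y|c x]; rewrite /kG_extend.
  rewrite -big_split; apply: eq_bigr => s _.
  by rewrite ffunE rmorphD mulrDl.
rewrite lact_Ak mulr_sumr; apply: eq_bigr => s _.
by rewrite ffunE rmorphM mulrA.
Qed.

Lemma kG_extend_u b s : kG_extend b (u s) = b s.
Proof.
rewrite /kG_extend (bigD1 s) //= kG_uE eqxx rmorph1 mul1r big1 ?addr0 // => t.
by move=> /negPf ts; rewrite kG_uE ts rmorph0 mul0r.
Qed.

(** * Colinear maps into A *)

Definition coeff (t : G) (z : tens Ak D) : A :=
  tlift (fun (x : Ak) (d : D) => (x : A) * kscal A ((d : {ffun G -> k}) t)) z.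

Lemma coeff_balanced t : balanced (fun (x : Ak) (d : D) =>
  (x : A) * kscal A ((d : {ffun G -> k}) t)).
Proof.
split=> [x x' d|x d d'|x c d]; first exact: mulrDl.
  by rewrite ffunE rmorphD mulrDr.
by rewrite ffunE rmorphM ract_Ak mulrA.
Qed.

Lemma coeff_sum t (F : G -> A) (v : G -> G) : injective v ->
  coeff (v t) (\sum_s ((F s : Ak) ⊗ u (v s))) = F t.
Proof.
move=> vI; have b := coeff_balanced (v t).
rewrite /coeff tlift_sum // (bigD1 t) //= tliftE // kG_uE eqxx rmorph1 mulr1.
rewrite big1 ?addr0 // => s /negPf st; rewrite tliftE // kG_uE (inj_eq vI).
by rewrite eq_sym st rmorph0 mulr0.
Qed.

(** Compare the coefficients of u_t in the colinearity equation at u_s; on the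
    right, u_t sits in the summand u_r (x) u_(r^-1 s) with r = s t^-1. *)
Lemma colinear_palpha (j : D -> Ak) s t :
  colinear (@comul _ _ D) (pa_kG_coact pa) j ->
  alpha t (j (u s)) = j (u (s * t^-1)%g).
Proof.
move=> [jh jc]; have [jD jl jr] := jh.
have b : balanced (fun x y : D => (j x : Ak) ⊗ y) by exact: tmap_balanced.
have := congr1 (coeff t) (jc (u s)).
rewrite /pa_kG_coact (coeff_sum t (fun s0 => alpha s0 (j (u s)))) // => ->.
have -> : comul (u s) = \sum_r (u r ⊗ u (r^-1 * s)%g) by exact: kG_comul_u.
rewrite /tmap tlift_sum //.
under eq_bigr do rewrite tliftE //.
have vI : injective (fun r : G => (r^-1 * s)%g).
  by move=> x y /mulIg /invg_inj.
have := coeff_sum (s * t^-1)%g (fun r => j (u r)) vI.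
by rewrite invMg invgK mulgKV.
Qed.

Lemma palpha_sum s I (r : seq I) (P : pred I) (F : I -> A) :
  alpha s (\sum_(i <- r | P i) F i) = \sum_(i <- r | P i) alpha s (F i).
Proof.
apply: (big_morph _ (palphaD pa s)).
by apply: (addrI (alpha s 0)); rewrite -palphaD !addr0.
Qed.

Section PalphaFamily.
Variable x : G -> A.
Hypothesis x_alpha : forall s t, alpha t (x s) = x (s * t^-1)%g.

(** Each x_s is a value of every alpha_t, hence lies in every ideal A e_t. *)
Lemma palpha_family_pe s t : x s * e t = x s.
Proof. by rewrite -[s](mulgK t) -x_alpha palpha_ideal. Qed.

(** The unit of A lies in the ideal generated by the x_s, hence in every A e_t. *)
Lemma pe_eq1 b : gconv x b =1 @gdelta A G -> forall t, e t = 1.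
Proof.
move=> xb t; have := xb 1%g; rewrite /gdelta eqxx => one.
rewrite -[e t]mulr1 -one /gconv mulr_sumr; apply: eq_bigr => s _.
by rewrite mulrA pe_central palpha_family_pe.
Qed.

(** A convolution inverse inherits the equivariance of x: translating it by r
    and applying alpha_r gives another right inverse. *)
Lemma inverse_palpha b : gconv x b =1 @gdelta A G -> gconv b x =1 @gdelta A G ->
  forall r s, alpha r (b (r^-1 * s)%g) = b s.
Proof.
move=> xb bx r s; apply/esym; move: s; apply: (gconv_inverse_uniq bx) => s.
have <- : alpha r (gdelta A s) = gdelta A s.
  rewrite /gdelta; case: eqP => _; first by rewrite palpha1 (pe_eq1 xb).
  by apply: (addrI (alpha r 0)); rewrite -palphaD !addr0.
rewrite -xb /gconv palpha_sum.
rewrite [RHS](reindex_inj (mulIg r)) /=; apply: eq_bigr => t _.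
by rewrite palphaM x_alpha mulgK invMg !mulgA.
Qed.

(** By equivariance, the t-th term on the left is the (s t^-1)-th term of the
    convolution product. *)
Lemma sum_palpha_gconv b s : \sum_t alpha t (x s) * b t = gconv x b s.
Proof.
rewrite [RHS](reindex_inj invg_inj) [RHS](reindex_inj (mulIg s^-1)%g) /=.
by apply: eq_bigr => t _; rewrite x_alpha invgK mulgKV invMg invgK.
Qed.

End PalphaFamily.

(** * The comodule structure in components *)

(** This is the element g a of C, where g is the grouplike sum of the nu_s. *)
Definition grouplike_ract (a : A) : C := pcor_mk pa (fun s => alpha s a).

Lemma grouplike_ractE a s : (grouplike_ract a : pcor pa) s = alpha s a.
Proof. by rewrite pcor_mkE palpha_ideal. Qed.

Lemma pa_coactE (a : Ar) : pa_coact pa a = (1 : Ar) ⊗ grouplike_ract a.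
Proof.
rewrite /pa_coact -tpure_sumr; congr (_ ⊗ _); apply/pcor_eqP=> t.
rewrite pcor_eval_sum grouplike_ractE (bigD1 t) // ract_nu nuE eqxx mul1r.
rewrite palpha_ideal big1 => [|s /negPf st]; first exact: addr0.
by rewrite ract_nu nuE eq_sym st.
Qed.

Section LeftLinear.
Variable q : C -> Ar -> A.
Hypothesis qDr : forall c y z, q c (y + z) = q c y + q c z.
Hypothesis qr : forall c y a, q c (y ◁ a) = q c y * a.
Hypothesis qDl : forall c c' y, q (c + c') y = q c y + q c' y.
Hypothesis ql : forall a c y, q (a ▷ c) y = a * q c y.

Lemma left_linear_nuE c y :
  q c y = (\sum_s (c : pcor pa) s * q (nu pa 1 s) (1 : A)) * (y : A).
Proof.
have q1 c' : q c' y = q c' (1 : A) * (y : A).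
  by rewrite -qr; congr (q c' _); rewrite [RHS]mul1r.
rewrite q1; congr (_ * _).
have q0 : q 0 (1 : A) = 0 by apply: (addrI (q 0 (1 : A))); rewrite -qDl !addr0.
rewrite {1}(pcor_sumE c).
rewrite (big_morph (fun c' => q c' (1 : A)) (fun a b => qDl a b _) q0).
by apply: eq_bigr => s _; rewrite nu_mul1 ql.
Qed.

Lemma q_lact_balanced c : balanced (fun (y : Ar) (z : C) => q c y ▷ z).
Proof.
split=> [x x' y|x y y'|x b y]; first by rewrite qDr lactDl.
  by rewrite lactDr.
by rewrite qr lactA.
Qed.

Lemma tlift_q_coact c (y : Ar) :
  tlift (fun (x0 : Ar) (x1 : C) => q c x0 ▷ x1) (pa_coact pa y)
  = q c (1 : A) ▷ grouplike_ract y.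
Proof. by rewrite pa_coactE (tliftE (q_lact_balanced c)). Qed.

Lemma tlift_q_comul (c : C) (y : Ar) r :
  (tlift (fun c1 c2 : C => c1 ◁ q c2 y) (pcor_comul c) : pcor pa) r
  = \sum_s (c : pcor pa) s * alpha r (q (nu pa 1 (r^-1 * s)%g) y).
Proof.
have b : balanced (fun c1 c2 : C => c1 ◁ q c2 y).
  split=> [x x' z|x z z'|x a z]; first by rewrite ractDl.
    by rewrite qDl ractDr.
  by rewrite ql ractA.
rewrite /pcor_comul tlift_sum // pcor_eval_sum; apply: eq_bigr => s _.
rewrite tlift_sum // pcor_eval_sum (bigD1 r) // tliftE // ract_nu nuE eqxx.
rewrite -mulrA palpha_ideal big1 => [|t /negPf tr].
  exact: addr0.
by rewrite tliftE // ract_nu nuE eq_sym tr.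
Qed.

Lemma lozengeE (p : D -> Ak) d y :
  lozenge (S := pa_comod pa) p q d y
  = (\sum_s alpha s (p d) * q (nu pa 1 s) (1 : A)) * (y : A).
Proof.
have b : balanced (fun (x0 : Ar) (x1 : C) => x0 ◁ q x1 y).
  split=> [x x' z|x z z'|x a z]; first by rewrite ractDl.
    by rewrite qDl ractDr.
  by rewrite ql ractA.
have cE : @coact _ _ _ (pa_comod pa) (p d) = _ := pa_coactE (p d).
rewrite /lozenge cE tliftE //.
transitivity (q (grouplike_ract (p d)) y); first exact: mul1r.
rewrite left_linear_nuE; congr (_ * _); apply: eq_bigr => s _.
by rewrite grouplike_ractE.
Qed.

(** The equivariance of p turns alpha_r(p(u_(t^-1 s))) into p(u_(t^-1 s r^-1)),
    so that alpha disappears and only a translated convolution is left. *)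
Lemma bulletE (p : D -> Ak) (c : C) r :
  colinear (@comul _ _ D) (pa_kG_coact pa) p ->
  (bullet (pa_ext pa) (S := pa_comod pa) q p c : pcor pa) r
  = \sum_s (c : pcor pa) s *
      gconv (fun t => q (nu pa 1 t) (1 : A)) (fun t => p (u t) : A) (s * r^-1)%g.
Proof.
move=> pc; have [[pD pl pr] _] := pc.
have qpE (c0 : rres C) (d : D) :
    tlift (fun (x0 : Ar) (x1 : C) => q c0 x0 ▷ x1) (pa_coact pa (p d))
    = q c0 (1 : A) ▷ grouplike_ract (p d) by exact: tlift_q_coact.
have b : balanced (fun (c0 : rres C) (d : D) =>
    tlift (fun (x0 : Ar) (x1 : C) => q c0 x0 ▷ x1) (pa_coact pa (p d))).
  split=> [x x' d|x d d'|x a d]; rewrite !qpE.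
  - by rewrite qDl lactDl.
  - rewrite -lactDr; congr (_ ▷ _); apply/pcor_eqP=> s.
    by rewrite pcor_addE !grouplike_ractE pD palphaD.
  - apply/pcor_eqP=> s; rewrite !pcor_lactE !grouplike_ractE pl lact_Ak.
    have -> : x ◁ a = kscal A a ▷ (x : C) by rewrite bm_central.
    by rewrite ql palphaZ mulrA kscalC.
rewrite /bullet [ext_coact _ _]/(pa_ext_coact (pa := pa) c) /pa_ext_coact.
rewrite tlift_sum // pcor_eval_sum; apply: eq_bigr => s _.
rewrite tlift_sum // pcor_eval_sum mulr_sumr; apply: eq_bigr => t _.
rewrite tliftE // qpE pcor_lactE grouplike_ractE [nu _ _ _]nu_mul1 ql.
by rewrite (colinear_palpha _ _ pc) -mulrA -mulgA.
Qed.

End LeftLinear.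

(** * The equivalence *)

Lemma colinear_ind_coact (j : D -> Ak) :
  colinear (@comul _ _ D) (pa_kG_coact pa) j <->
  colinear (@comul _ _ D) (ind_coact (pa_ext pa) (S := pa_comod pa)) j.
Proof.
by split=> -[jh jc]; split=> // d; have := jc d; rewrite pa_kG_coactE.
Qed.

Lemma cleft_bicomodule_extension :
  cleft_bicomodule (pa_ext pa) (pa_comod pa) -> pa_cleft_extension pa.
Proof.
move=> [j] [q] [/colinear_ind_coact jc [qDr qr qDl ql _] qj jq].
have [jh _] := jc; have x_alpha s t := colinear_palpha s t jc.
set b := fun s => q (nu pa 1 s) (1 : A); set x := fun s => j (u s) : A.
have xb : gconv x b =1 @gdelta A G.
  move=> s; rewrite -sum_palpha_gconv //; have := jq (u s) (1 : A).
  by rewrite lozengeE // mulr1 -kscal_counit_u => ->; exact: mulr1.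
have bx : gconv b x =1 @gdelta A G.
  move=> s; have e1 := pe_eq1 x_alpha xb.
  (* The component of q . j = id at the unit of G: there the translation in
     [bulletE] is trivial, and nu_s has component delta(s) because e_s = 1. *)
  have := congr1 (fun c : pcor pa => c 1%g) (qj (nu pa 1 s)).
  rewrite bulletE // nuE mul1r e1 eq_sym -/(gdelta A s) => <-.
  rewrite (bigD1 s) //= nuE eqxx e1 !mul1r invg1 mulg1 big1 ?addr0 // => t /negPf ts.
  by rewrite nuE ts mul0r.
exists j; split=> //; exists (kG_extend b); have bh := kG_extend_hom b.
split=> // d; rewrite convolE // kscal_counit; apply: eq_bigr => s _; congr (_ * _).
- by rewrite -xb; apply: eq_bigr => t _; rewrite kG_extend_u.
- by rewrite -bx; apply: eq_bigr => t _; rewrite kG_extend_u.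
Qed.

Lemma convol_gconv (f g : D -> Ak) : bm_hom f -> bm_hom g ->
  (forall d, convol f g d = kscal A (counit d)) ->
  gconv (fun t => f (u t) : A) (fun t => g (u t) : A) =1 @gdelta A G.
Proof.
move=> fh gh fg s; have := fg (u s); rewrite convolE // (bigD1 s) //=.
rewrite kG_uE eqxx rmorph1 mul1r big1 ?addr0 => [->|t /negPf ts].
  exact: kscal_counit_u.
by rewrite kG_uE ts rmorph0 mul0r.
Qed.

Lemma cleft_extension_bicomodule :
  pa_cleft_extension pa -> cleft_bicomodule (pa_ext pa) (pa_comod pa).
Proof.
move=> [j] [jc [j' [j'h jj' j'j]]].
have [jh _] := jc; have x_alpha s t := colinear_palpha s t jc.
set x := fun s => j (u s) : A in x_alpha; pose b s := j' (u s) : A.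
have xb : gconv x b =1 @gdelta A G by exact: convol_gconv.
have bx : gconv b x =1 @gdelta A G by exact: convol_gconv.
have e1 := pe_eq1 x_alpha xb; have b_alpha := inverse_palpha x_alpha xb bx.
pose q (c : C) (y : Ar) : A := (\sum_s (c : pcor pa) s * b s) * (y : A).
have qnu s y : q (nu pa 1 s) y = b s * (y : A).
  rewrite /q (bigD1 s) //= nuE eqxx e1 !mul1r big1 ?addr0 // => t /negPf ts.
  by rewrite nuE ts mul0r.
have qDr c y z : q c (y + z) = q c y + q c z by exact: mulrDr.
have qr c y a : q c (y ◁ a) = q c y * a by exact: mulrA.
have qDl c c' y : q (c + c') y = q c y + q c' y.
  rewrite /q -mulrDl -big_split; congr (_ * _); apply: eq_bigr => s _.
  by rewrite pcor_addE mulrDl.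
have ql a c y : q (a ▷ c) y = a * q c y.
  rewrite /q mulrA mulr_sumr; congr (_ * _); apply: eq_bigr => s _.
  by rewrite pcor_lactE mulrA.
exists j, q; split; first exact/colinear_ind_coact.
- split=> // c y; rewrite [coact _]/(pa_coact pa y) (tlift_q_coact qDr qr).
  apply/pcor_eqP=> r; rewrite [comul _]/(pcor_comul c) (tlift_q_comul qDl ql).
  rewrite pcor_lactE grouplike_ractE {2}/q mulr1 mulr_suml; apply: eq_bigr => s _.
  by rewrite qnu palphaM b_alpha mulrA.
- move=> c; apply/pcor_eqP=> r; rewrite bulletE //.
  have cE s : gconv (fun t => q (nu pa 1 t) (1 : A)) x s = gdelta A s.
    by rewrite -bx; apply: eq_bigr => t _; rewrite qnu mulr1.
  rewrite (bigD1 r) //= cE mulgV /gdelta eqxx mulr1 big1 ?addr0 // => s /negPf sr.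
  by rewrite cE /gdelta -eq_mulgV1 sr mulr0.
- move=> d y; rewrite lozengeE //; transitivity (kscal A (counit d) * (y : A)) => //.
  rewrite -jj' convolE // (kG_homE d jh); congr (_ * _).
  under eq_bigr do rewrite qnu mulr1 palpha_sum mulr_suml.
  rewrite exchange_big; apply: eq_bigr => s _.
  rewrite -(sum_palpha_gconv x_alpha b s) mulr_sumr.
  by apply: eq_bigr => t _; rewrite palphaZ mulrA.
Qed.

End PartialActionCleft.

Theorem proposition6p4 (k : comPzRingType) (A : kalg k) (G : finGroupType)
    (pa : paction A G) :
  pa_cleft_extension pa <-> cleft_bicomodule (pa_ext pa) (pa_comod pa).
Proof.
split; [exact: cleft_extension_bicomodule|exact: cleft_bicomodule_extension].
Qed.
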